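(* Let $(\mathbb{E},\circ,\bullet)$ be a Euclidean Jordan algebra of dimension $n$ and rank $\mathrm{rk}$, and let $m\ge1$ be an integer. Let $\mathfrak{F}_{\rm c}(\mathbb{E})$ be a complete set of representatives of the $\mathfrak{S}_{\mathrm{rk}}$-orbits in $\mathfrak{F}(\mathbb{E})$. Let $\mathcal{K}\subseteq\mathcal{S}^{\mathrm{rk},m}$ be a permutation-invariant set and let $\mathfrak{F}$ satisfy $\mathfrak{F}_{\rm c}(\mathbb{E})\subseteq\mathfrak{F}\subseteq\mathfrak{F}(\mathbb{E})$. Then the set $$\bigcap_{(c_1,\dots,c_{\mathrm{rk}})\in\mathfrak{F}}\{\mathcal{A}\in\mathcal{S}^{n,m}(\mathbb{E})\mid\mathcal{A}(c_1,\dots,c_{\mathrm{rk}})\in\mathcal{K}\}$$ is the same regardless of the choice of $\mathfrak{F}$. In particular, the claim holds when $\mathcal{K}=\mathcal{COP}^{\mathrm{rk},m}$, and it follows that $$\mathcal{COP}^{n,m}(\mathbb{E}_+)=\bigcap_{(c_1,\dots,c_{\mathrm{rk}})\in\mathfrak{F}}\{\mathcal{A}\in\mathcal{S}^{n,m}(\mathbb{E})\mid\mathcal{A}(c_1,\dots,c_{\mathrm{rk}})\in\mathcal{COP}^{\mathrm{rk},m}\}.$$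
   Context: A Euclidean Jordan algebra $(\mathbb{E},\circ,\bullet)$ is a finite-dimensional real vector space with a bilinear product $\circ$ such that $x\circ y=y\circ x$ and $x\circ((x\circ x)\circ y)=(x\circ x)\circ(x\circ y)$, having an identity element $e$ for $\circ$, together with a fixed inner product $\bullet$ satisfying $(x\circ y)\bullet z=x\bullet(y\circ z)$. Its symmetric cone is $\mathbb{E}_+=\{x\circ x\mid x\in\mathbb{E}\}$. An idempotent ($c\circ c=c$) is primitive if it is nonzero and not the sum of two nonzero idempotents. A Jordan frame is a system $c_1,\dots,c_k$ of primitive idempotents with $c_i\circ c_j=0$ for $i\ne j$ and $\sum_i c_i=e$; every Jordan frame has exactly $\mathrm{rk}$ elements ($\mathrm{rk}$ is the rank). $\mathfrak{F}(\mathbb{E})$ is the set of ordered Jordan frames $(c_1,\dots,c_{\mathrm{rk}})$; the symmetric group $\mathfrak{S}_{\mathrm{rk}}$ acts on it by $\sigma\cdot(c_1,\dots,c_{\mathrm{rk}})=(c_{\sigma(1)},\dots,c_{\sigma(\mathrm{rk})})$. $\mathcal{S}^{n,m}(\mathbb{E})$ is the space of symmetric tensors of order $m$ over $\mathbb{E}$ with the inner product $\langle\cdot,\cdot\rangle$ induced by $\bullet$ ($\langle x_1\otimes\cdots\otimes x_m,y_1\otimes\cdots\otimes y_m\rangle=\prod_i x_i\bullet y_i$); $\mathcal{S}^{k,m}=\mathcal{S}^{k,m}(\mathbb{R}^k)$ with the standard inner product. $\mathcal{COP}^{n,m}(\mathbb{E}_+)=\{\mathcal{A}\in\mathcal{S}^{n,m}(\mathbb{E})\mid\langle\mathcal{A},x^{\otimes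 m}\rangle\ge0\ \forall x\in\mathbb{E}_+\}$, $\mathcal{COP}^{k,m}=\{\mathcal{B}\in\mathcal{S}^{k,m}\mid\langle\mathcal{B},\boldsymbol{x}^{\otimes m}\rangle\ge0\ \forall\boldsymbol{x}\in\mathbb{R}_+^k\}$. For $\mathcal{A}\in\mathcal{S}^{n,m}(\mathbb{E})$ and $(c_1,\dots,c_{\mathrm{rk}})\in\mathfrak{F}(\mathbb{E})$, $\mathcal{A}(c_1,\dots,c_{\mathrm{rk}})\in\mathcal{S}^{\mathrm{rk},m}$ is the tensor with $(i_1,\dots,i_m)$th element $\langle\mathcal{A},c_{i_1}\otimes\cdots\otimes c_{i_m}\rangle$. A set $\mathcal{K}\subseteq\mathcal{S}^{k,m}$ is permutation-invariant if $\mathscr{P}_\sigma\mathcal{K}=\mathcal{K}$ for all $\sigma\in\mathfrak{S}_k$, where $(\mathscr{P}_\sigma\mathcal{B})_{i_1\cdots i_m}=\mathcal{B}_{\sigma(i_1)\cdots\sigma(i_m)}$. *)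

(* Defs.v *)
From HB Require Import structures.
From mathcomp Require Import all_boot all_order all_algebra perm sesquilinear.
From mathcomp Require Import boolp classical_sets reals.

Set Implicit Arguments.
Unset Strict Implicit.
Unset Printing Implicit Defensive.

Import Order.TTheory GRing.Theory Num.Theory.
Local Open Scope classical_set_scope.
Local Open Scope ring_scope.

Record euclidean_jordan (R : realType) (E : vectType R) := EuclideanJordan {
  jmul : {bilinear E -> E -> E};
  jone : E;
  jdot : {dot E for idfun};
  jmulC : forall x y, jmul x y = jmul y x;
  jmul_jordan : forall x y,
    jmul x (jmul (jmul x x) y) = jmul (jmul x x) (jmul x y);
  jmul1 : forall x, jmul jone x = x;
  jdot_assoc : forall x y z, jdot (jmul x y) z = jdot x (jmul y z)
}.

Section Jordan.
Variables (R : realType) (E : vectType R) (J : euclidean_jordan E).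

Definition symmetric_cone : set E := [set y | exists x, y = jmul J x x].

Definition jidempotent (c : E) : Prop := jmul J c c = c.

Definition primitive_idempotent (c : E) : Prop :=
  [/\ jidempotent c, c != 0 &
      ~ exists a b, [/\ jidempotent a, jidempotent b, a != 0, b != 0 & c = a + b]].

Definition jordan_frame k (c : {ffun 'I_k -> E}) : Prop :=
  [/\ forall i, primitive_idempotent (c i),
      forall i j, i != j -> jmul J (c i) (c j) = 0 &
      \sum_i c i = jone J].

Definition jpow (x : E) (k : nat) : E := iter k (jmul J x) (jone J).

Definition jpow_dependent (x : E) (k : nat) : bool :=
  ~~ free [seq jpow x i | i <- iota 0 k.+1].

Lemma jpow_dependent_ex (x : E) : exists k, jpow_dependent x k.
Proof.
exists (\dim {:E}); rewrite /jpow_dependent /free size_map size_iota.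
by rewrite neq_ltn ltnS dimvS ?subvf.
Qed.

(* The degree of the minimal polynomial of [x]: the least [k] such that
   e, x, ..., x^k are linearly dependent. *)
Definition jdegree (x : E) : nat := ex_minn (jpow_dependent_ex x).

Definition is_jdegree (k : nat) : bool := `[< exists x, jdegree x = k >].

Lemma is_jdegree_ex : exists k, is_jdegree k.
Proof. by exists (jdegree 0); apply/asboolP; exists 0. Qed.

Lemma is_jdegree_le k : is_jdegree k -> (k <= \dim {:E})%N.
Proof.
move=> /asboolP[x <-]; rewrite /jdegree; case: ex_minnP => d _; apply.
rewrite /jpow_dependent /free size_map size_iota.
by rewrite neq_ltn ltnS dimvS ?subvf.
Qed.

(* The rank is the maximal degree of a minimal polynomial; it is also the
   number of elements of any Jordan frame. *)
Definition jrank : nat := ex_maxn is_jdegree_ex is_jdegree_le.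

Definition jframes : set {ffun 'I_jrank -> E} :=
  [set c | jordan_frame c].

Definition frame_act (s : 'S_jrank) (c : {ffun 'I_jrank -> E}) :
  {ffun 'I_jrank -> E} := [ffun i => c (s i)].

Definition complete_representatives (Fc : set {ffun 'I_jrank -> E}) : Prop :=
  Fc `<=` jframes /\
  forall c, jframes c ->
    exists! d, Fc d /\ exists s : 'S_jrank, d = frame_act s c.

End Jordan.

Arguments jframes {R E} J.
Arguments complete_representatives {R E} J.

(* Order-[m] tensors over a [k]-dimensional space, given by their [k ^ m]
   coordinates. *)
Definition tensor (R : realType) (k m : nat) :=
  {ffun {ffun 'I_m -> 'I_k} -> R}.

Definition symmetric_tensor (R : realType) k m : set (tensor R k m) :=
  [set A | forall (s : 'S_m) (I : {ffun 'I_m -> 'I_k}),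
             A [ffun j => I (s j)] = A I].
Arguments symmetric_tensor {R k m}.

Section StandardTensors.
Variables (R : realType) (k m : nat).

Definition tensor_dot (A B : tensor R k m) : R := \sum_I A I * B I.

Definition tensor_power (x : 'rV[R]_k) : tensor R k m :=
  [ffun I : {ffun 'I_m -> 'I_k} => \prod_j x 0 (I j)].

Definition copositive : set (tensor R k m) :=
  [set B | symmetric_tensor B /\
    forall x : 'rV[R]_k, (forall i, 0 <= x 0 i) ->
      0 <= tensor_dot B (tensor_power x)].

Definition tensor_perm (s : 'S_k) (B : tensor R k m) : tensor R k m :=
  [ffun I : {ffun 'I_m -> 'I_k} => B [ffun j => s (I j)]].

Definition permutation_invariant (K : set (tensor R k m)) : Prop :=
  forall s : 'S_k, [set tensor_perm s B | B in K] = K.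

End StandardTensors.

Arguments copositive {R k m}.

(* A tensor over [E] is represented by its coordinates in the basis
   b_(i_1) (x) ... (x) b_(i_m) of the tensor power of [E], where [b] is the
   basis [vbasis {:E}]. As [b] need not be orthonormal, the induced inner
   product involves its Gram matrix; [jtensor_dot_pure] and
   [jtensor_decomp] show that it is the intended one. *)
Section JordanTensors.
Variables (R : realType) (E : vectType R) (J : euclidean_jordan E) (m : nat).

Definition jtensor := tensor R (\dim {:E}) m.

Local Notation b := (vbasis {:E}).

Definition pure_tensor (x : 'I_m -> E) : jtensor :=
  [ffun I : {ffun 'I_m -> 'I_(\dim {:E})} => \prod_j coord b (I j) (x j)].

Definition jtensor_dot (A B : jtensor) : R :=
  \sum_I \sum_I' A I * B I' * \prod_j jdot J b`_(I j) b`_(I' j).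

Lemma jtensor_dot_pure (x y : 'I_m -> E) :
  jtensor_dot (pure_tensor x) (pure_tensor y) = \prod_j jdot J (x j) (y j).
Proof.
pose g j i i' := coord b i (x j) * coord b i' (y j) * jdot J b`_i b`_i'.
have gE j : jdot J (x j) (y j) = \sum_i \sum_i' g j i i'.
  rewrite {1}(coord_vbasis (memvf (x j))) {1}(coord_vbasis (memvf (y j))).
  rewrite linear_sumlz; apply: eq_bigr => i _.
  rewrite linear_sumr; apply: eq_bigr => i' _.
  by rewrite linearZl_LR linearZr_LR /g /= mulrA.
under [RHS]eq_bigr do rewrite gE.
rewrite bigA_distr_bigA; apply: eq_bigr => I _.
rewrite bigA_distr_bigA; apply: eq_bigr => I' _.
by rewrite !ffunE -!big_split.
Qed.

Lemma jtensor_decomp (A : jtensor) I :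
  A I = \sum_I' A I' * pure_tensor (fun j => b`_(I' j)) I.
Proof.
rewrite (bigD1 I) //= big1 ?addr0 => [|I' neqI].
  rewrite !ffunE big1 ?mulr1 // => j _.
  by rewrite coord_free ?(basis_free (vbasisP _)) // eqxx.
rewrite !ffunE; suff [j neqj] : exists j, I' j != I j.
  rewrite (bigD1 j) //= coord_free ?(basis_free (vbasisP _)) //.
  by rewrite (negPf neqj) mul0r mulr0.
apply/existsP; rewrite -negb_forall; apply: contra neqI => /forallP eqI.
by apply/eqP/ffunP => j; rewrite (eqP (eqI j)).
Qed.

Definition jcopositive : set jtensor :=
  [set A | symmetric_tensor A /\
    forall x : E, symmetric_cone J x ->
      0 <= jtensor_dot A (pure_tensor (fun _ => x))].

Definition tensor_at k (A : jtensor) (c : {ffun 'I_k -> E}) : tensor R k m :=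
  [ffun I : {ffun 'I_m -> 'I_k} => jtensor_dot A (pure_tensor (fun j => c (I j)))].

Definition frame_inter (K : set (tensor R (jrank J) m))
    (F : set {ffun 'I_(jrank J) -> E}) : set jtensor :=
  \bigcap_(c in F) [set A | symmetric_tensor A /\ K (tensor_at A c)].

End JordanTensors.

Arguments jcopositive {R E} J {m}.

(* Main.v *)
From HB Require Import structures.
Require Import Defs.
From mathcomp Require Import all_boot all_order all_algebra perm sesquilinear.
From mathcomp Require Import boolp classical_sets reals complex polyrcf.
From mathcomp Require Import ring lra.

(* A frame change by a permutation acts on [tensor_at] by [tensor_perm], so a
   permutation-invariant [K] only sees orbits of frames.

   For the copositive cone it remains to test a tensor on the squares of [E]
   through Jordan frames. Powers of one element associate, and by positivity
   of the inner product the minimal polynomial of [x] splits over R with simple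
   roots; evaluating the Lagrange polynomials at [x] yields as many orthogonal
   idempotents as its degree, whose span contains [x]. If that degree is the
   rank, these idempotents are primitive, since splitting one of them would
   give an element of larger degree. A general [x] is joined to some [x0] of
   maximal degree by a line; on it the degree is maximal outside the zeros of a
   nonzero polynomial, and the pairing of the tensor with the power of the
   square is polynomial, so nonnegativity extends to all points of the line.
   This avoids proving that all Jordan frames have the same cardinality. *)

Set Implicit Arguments.
Unset Strict Implicit.
Unset Printing Implicit Defensive.

Import Order.TTheory GRing.Theory Num.Theory.
Local Open Scope ring_scope.

(** * Linearizations of the Jordan identity *)

Section JordanIdentities.
Variables (R : realType) (E : vectType R) (J : euclidean_jordan E).

Local Notation "x *o y" := (jmul J x y) (at level 40, left associativity).
Local Notation dot := (jdot J).

Lemma jmulDl x y z : (x + y) *o z = x *o z + y *o z.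
Proof. exact: linearDl. Qed.

Lemma jmulDr x y z : x *o (y + z) = x *o y + x *o z.
Proof. exact: linearDr. Qed.

Lemma jmulNl x y : (- x) *o y = - (x *o y).
Proof. exact: linearNl. Qed.

Lemma jmulNr x y : x *o (- y) = - (x *o y).
Proof. exact: linearNr. Qed.

Lemma jmulZl a x y : (a *: x) *o y = a *: (x *o y).
Proof. exact: linearZl_LR. Qed.

Lemma jmulZr a x y : x *o (a *: y) = a *: (x *o y).
Proof. exact: linearZr_LR. Qed.

Lemma jmul0l x : 0 *o x = 0.
Proof. exact: linear0l. Qed.

Lemma jmul0r x : x *o 0 = 0.
Proof. exact: linear0r. Qed.

Lemma jmulr1 x : x *o jone J = x.
Proof. by rewrite jmulC jmul1. Qed.

Lemma jmul_suml I (r : seq I) (P : pred I) (F : I -> E) x :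
  (\sum_(i <- r | P i) F i) *o x = \sum_(i <- r | P i) F i *o x.
Proof. exact: linear_sumlz. Qed.

Lemma jmul_sumr I (r : seq I) (P : pred I) (F : I -> E) x :
  x *o (\sum_(i <- r | P i) F i) = \sum_(i <- r | P i) x *o F i.
Proof. exact: linear_sumr. Qed.

Lemma jdotDl x y z : dot (x + y) z = dot x z + dot y z.
Proof. exact: linearDl. Qed.

Lemma jdotDr x y z : dot x (y + z) = dot x y + dot x z.
Proof. exact: linearDr. Qed.

Lemma jdotNl x y : dot (- x) y = - dot x y.
Proof. exact: linearNl. Qed.

Lemma jdotZl a x y : dot (a *: x) y = a * dot x y.
Proof. exact: linearZl_LR. Qed.

Lemma jdotZr a x y : dot x (a *: y) = a * dot x y.
Proof. exact: linearZr_LR. Qed.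

Lemma jdot0l x : dot 0 x = 0.
Proof. exact: linear0l. Qed.

Lemma jdotC x y : dot x y = dot y x.
Proof. by rewrite hermC expr0 mul1r. Qed.

Lemma jdotNr x y : dot x (- y) = - dot x y.
Proof. by rewrite jdotC jdotNl jdotC. Qed.

Lemma jdot_eq0 x : dot x x = 0 -> x = 0.
Proof.
move=> h; apply/eqP; apply: contraTT isT => /(neq0_dnorm_gt0 (s := dot)).
by rewrite h ltxx.
Qed.

Lemma jdot_ge0 x : 0 <= dot x x.
Proof.
have [->|/(neq0_dnorm_gt0 (s := dot)) /ltW //] := eqVneq x 0.
by rewrite jdot0l.
Qed.

Lemma jdot_inj x y : (forall w, dot x w = dot y w) -> x = y.
Proof.
move=> h; apply/eqP; rewrite -subr_eq0; apply/eqP/jdot_eq0.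
by rewrite jdotDl jdotNl h subrr.
Qed.

Let dotE := (jdotDl, jdotNl, jdotZl, jdot0l).
Let mulE := (jmulDl, jmulDr, jmulNl, jmulNr).

(* Pairing with an arbitrary vector turns linear combinations of vector
   identities into linear arithmetic. *)
Lemma jmul_jordan2 x z y :
  x *o ((x *o z) *o y) + x *o ((x *o z) *o y) + z *o ((x *o x) *o y) =
  (x *o z) *o (x *o y) + (x *o z) *o (x *o y) + (x *o x) *o (z *o y).
Proof.
have h1 := jmul_jordan J (x + z) y.
have h2 := jmul_jordan J (x - z) y.
have h3 := jmul_jordan J z y.
move: h1 h2; rewrite !mulE !opprK (jmulC J z x) => h1 h2.
apply: jdot_inj => w.
move: (congr1 (dot^~ w) h1) (congr1 (dot^~ w) h2) (congr1 (dot^~ w) h3).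
by rewrite /= !dotE; lra.
Qed.

(** Polarizes [jmul_jordan2] once more, now in [x]: the identity at [x + u] minus those at [x] and
    [u] leaves the mixed terms. *)
Lemma jmul_jordan3 x u z y :
  x *o ((u *o z) *o y) + u *o ((x *o z) *o y) + z *o ((x *o u) *o y) =
  (u *o z) *o (x *o y) + (x *o z) *o (u *o y) + (x *o u) *o (z *o y).
Proof.
have h1 := jmul_jordan2 (x + u) z y.
have h2 := jmul_jordan2 x z y.
have h3 := jmul_jordan2 u z y.
move: h1; rewrite !mulE (jmulC J u x) => h1.
apply: jdot_inj => w.
move: (congr1 (dot^~ w) h1) (congr1 (dot^~ w) h2) (congr1 (dot^~ w) h3).
by rewrite /= !dotE; lra.
Qed.

(** Solves [jmul_jordan3] for its term [z *o ((x *o u) *o y)]. Multiplication by a triple product is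
    thus a polynomial in multiplications by the factors and by products of two of them. *)
Lemma jmul_mulA x u y z :
  ((x *o u) *o y) *o z =
  (x *o y) *o (u *o z) + (u *o y) *o (x *o z) + (x *o u) *o (y *o z)
  - x *o (y *o (u *o z)) - u *o (y *o (x *o z)).
Proof.
have := jmul_jordan3 x u z y.
rewrite (jmulC J z (_ *o y)) (jmulC J (u *o z) y) (jmulC J (x *o z) y).
rewrite (jmulC J (u *o z) (_ *o y)) (jmulC J (x *o z) (_ *o y)) (jmulC J z y).
move=> h; apply: jdot_inj => w; move: (congr1 (dot^~ w) h).
by rewrite /= !dotE; lra.
Qed.

End JordanIdentities.

(** * Power associativity, evaluation of polynomials and minimal degree *)

Section Powers.
Variables (R : realType) (E : vectType R) (J : euclidean_jordan E).

Local Notation "x *o y" := (jmul J x y) (at level 40, left associativity).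
Local Notation dot := (jdot J).
Local Notation jpow := (jpow J).

(** The induction carries two consecutive powers: by [jmul_mulA], multiplication by [jpow x n.+2] is
    a polynomial in the multiplications by [x], [x *o x], [jpow x n] and [jpow x n.+1]. The one by
    [x *o x] commutes with that by [x] by the Jordan identity, the last two by induction. *)
Lemma jpow_comm x n z : x *o (jpow x n *o z) = jpow x n *o (x *o z).
Proof.
suff: (forall z, x *o (jpow x n *o z) = jpow x n *o (x *o z)) /\
      (forall z, x *o (jpow x n.+1 *o z) = jpow x n.+1 *o (x *o z)).
  by case.
elim: n => [|n [IH0 IH1]]; first by rewrite /= jmulr1; split=> t; rewrite ?jmul1.
split=> // t; have powSS u : jpow x n.+2 *o u =
    (x *o x) *o (jpow x n *o u) + jpow x n.+1 *o (x *o u)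
    + jpow x n.+1 *o (x *o u)
    - x *o (x *o (jpow x n *o u)) - jpow x n *o (x *o (x *o u)).
  have -> : jpow x n.+2 = (x *o jpow x n) *o x by rewrite jmulC.
  by rewrite jmul_mulA (jmulC J (jpow x n) x).
rewrite !powSS !(jmulDr, jmulNr) (jmul_jordan J x (jpow x n *o t)).
by rewrite !IH1 !IH0.
Qed.

Lemma jpow_add x n k : jpow x n *o jpow x k = jpow x (n + k).
Proof.
elim: k => [|k IH]; first by rewrite addn0 jmulr1.
by rewrite addnS /= -!/(jpow _ _) -jpow_comm IH.
Qed.

(** The product of [E] is not associative, so evaluation is built on [jpow]; power associativity
    makes it multiplicative in [jhornerM]. *)
Definition jhorner x (p : {poly R}) : E := \sum_(i < size p) p`_i *: jpow x i.

Lemma jhorner_widen x (p : {poly R}) n : (size p <= n)%N ->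
  jhorner x p = \sum_(i < n) p`_i *: jpow x i.
Proof.
move=> le_pn; rewrite /jhorner (big_ord_widen n (fun i => p`_i *: jpow x i)) //.
rewrite big_mkcond; apply: eq_bigr => i _; case: ltnP => // /(nth_default 0) ->.
by rewrite scale0r.
Qed.

Lemma jhorner_is_linear x : linear (jhorner x).
Proof.
move=> a p q; pose n := maxn (size (a *: p + q)) (maxn (size p) (size q)).
rewrite !(@jhorner_widen _ _ n) ?leq_max ?leqnn ?orbT //.
rewrite scaler_sumr -big_split; apply: eq_bigr => i _ /=.
by rewrite coefD coefZ scalerDl scalerA.
Qed.

HB.instance Definition _ x :=
  GRing.isLinear.Build R {poly R} E _ (jhorner x) (jhorner_is_linear x).

Lemma jhornerXn x n : jhorner x 'X^n = jpow x n.
Proof.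
rewrite /jhorner size_polyXn (bigD1 ord_max) //= coefXn eqxx scale1r.
rewrite big1 ?addr0 // => i neq_in; rewrite coefXn.
by rewrite (_ : (i == n :> nat) = false) ?scale0r //; apply: negPf.
Qed.

Lemma jhorner1 x : jhorner x 1 = jone J.
Proof. by rewrite -(expr0 'X) jhornerXn. Qed.

Lemma jhornerX x : jhorner x 'X = x.
Proof. by rewrite -(expr1 'X) jhornerXn /= jmulr1. Qed.

Lemma jhornerM x p q : jhorner x (p * q) = jhorner x p *o jhorner x q.
Proof.
rewrite -[p in LHS]coefK -[q in LHS]coefK !poly_def mulr_suml linear_sum.
rewrite [jhorner x p]/jhorner jmul_suml; apply: eq_bigr => i _.
rewrite mulr_sumr linear_sum [jhorner x q]/jhorner jmul_sumr.
apply: eq_bigr => j _; rewrite -scalerAl -scalerAr -exprD !linearZ /=.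
by rewrite jhornerXn jmulZl jpow_add !scalerA mulrC.
Qed.

Lemma jpow_dependentP x k :
  reflect (exists q : {poly R},
             [/\ q != 0, (size q <= k.+1)%N & jhorner x q = 0])
          (jpow_dependent J x k).
Proof.
pose X := [tuple of [seq jpow x i | i <- iota_tuple k.+1 0]].
have nthX (i : 'I_k.+1) : X`_i = jpow x i.
  by rewrite (nth_map 0%N) ?size_iota // nth_iota.
rewrite -[jpow_dependent J x k]/(~~ free X).
apply: (iffP idP) => [depX | [q [q0 le_q hq]]].
  have /existsNP[f /not_implyP[sum0 /existsNP[i fi]]] := elimN freeP depX.
  exists (\poly_(i < k.+1) f (inord i)); split.
  - apply/negP => /eqP/polyP/(_ i); rewrite coef_poly ltn_ord inord_val coef0.
    exact: fi.
  - exact: size_poly.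
  - rewrite (@jhorner_widen _ _ k.+1) ?size_poly // -[RHS]sum0.
    by apply: eq_bigr => j _; rewrite coef_poly ltn_ord inord_val nthX.
apply/negP => freeX; have h := elimT freeP freeX (fun i => q`_i).
case/eqP: q0.
apply/polyP => i; rewrite coef0; have [lt_ik|le_ki] := ltnP i k.+1.
  apply: (h _ (Ordinal lt_ik)); rewrite -[RHS]hq (@jhorner_widen _ _ k.+1) //.
  by apply: eq_bigr => j _; rewrite nthX.
by rewrite nth_default // (leq_trans le_q).
Qed.

Lemma jdegree_min x q : q != 0 -> jhorner x q = 0 -> (jdegree J x < size q)%N.
Proof.
move=> q0 hq; rewrite /jdegree; case: ex_minnP => d _ /(_ (size q).-1).
have sq : (size q).-1.+1 = size q by rewrite prednK // size_poly_gt0.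
rewrite -[X in (_ < X)%N]sq ltnS; apply.
by apply/jpow_dependentP; exists q; rewrite sq.
Qed.

(** By [jdegree_min], this [p] is the minimal polynomial of [x] up to a scalar. *)
Lemma jdegree_annihilator x :
  exists p : {poly R}, size p = (jdegree J x).+1 /\ jhorner x p = 0.
Proof.
have /jpow_dependentP[p [p0 le_p hp]] : jpow_dependent J x (jdegree J x).
  by rewrite /jdegree; case: ex_minnP.
by exists p; split=> //; apply/eqP; rewrite eqn_leq le_p jdegree_min.
Qed.

Lemma jrank_ge x : (jdegree J x <= jrank J)%N.
Proof.
rewrite /jrank; case: ex_maxnP => r _; apply; apply/asboolP; by exists x.
Qed.

Lemma jrank_attained : exists x, jdegree J x = jrank J.
Proof. by rewrite /jrank; case: ex_maxnP => r /asboolP. Qed.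
End Powers.

(** * Factors of real polynomials *)

Section RealFactors.
Variable R : rcfType.

(** Take a complex root [a + ib]. If [b] is nonzero, the remainder of [q] modulo the quadratic is
    real of degree at most 1 and vanishes at [a + ib]; the imaginary part kills its linear
    coefficient, then the real part its constant one. *)
Lemma real_root_or_quadratic_factor (q : {poly R}) : (1 < size q)%N ->
  exists a b, (('X - a%:P) ^+ 2 + (b ^+ 2)%:P %| q) \/ root q a.
Proof.
move=> q_gt1; pose f := real_complex R.
have /closed_rootP[[a b] /rootP qz] : size (map_poly f q) != 1%N.
  by rewrite size_map_poly; case: size q_gt1 => [|[]].
exists a, b; have [b0|b_neq0] := eqVneq b 0.
  right; apply/rootP/(fmorph_inj f); rewrite rmorph0 -qz b0.
  by rewrite -horner_map.
left; set d := _ + _; pose r := q %% d.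
have size_d : size d = 3%N.
  rewrite size_polyDl size_exp_XsubC //.
  exact: leq_ltn_trans (size_polyC_leq1 _) _.
have d_neq0 : d != 0 by rewrite -size_poly_gt0 size_d.
have dz : (map_poly f d).[Complex a b] = 0.
  rewrite rmorphD rmorphXn rmorphB /= map_polyX !map_polyC /=.
  rewrite !hornerE; apply/eqP; rewrite eq_complex /= expr2 /=.
  by apply/andP; split; apply/eqP; ring.
have rz : (map_poly f r).[Complex a b] = 0.
  move: qz; rewrite [q in map_poly f q](divp_eq q d) rmorphD rmorphM.
  by rewrite hornerD hornerM dz mulr0 add0r.
have size_r : (size r <= 2)%N by rewrite -ltnS -size_d ltn_modp.
move: rz; rewrite (@horner_coef_wide _ 2) ?size_map_poly //.
rewrite !big_ord_recr big_ord0 /=.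
rewrite add0r !coef_map /= expr0 expr1 mulr1 => /eqP.
rewrite eq_complex /= => /andP[/eqP re0 /eqP im0].
have r1 : r`_1 = 0.
  have /eqP : r`_1 * b = 0 by rewrite -[RHS]im0; ring.
  by rewrite mulf_eq0 (negPf b_neq0) orbF => /eqP.
have r0 : r`_0 = 0 by rewrite -[RHS]re0 r1; ring.
apply/eqP/polyP => -[|[|i]]; rewrite coef0 //.
by rewrite nth_default // (leq_trans size_r).
Qed.
End RealFactors.

(** * Peirce positivity and splitting of the minimal polynomial *)

Section Idempotents.
Variables (R : realType) (E : vectType R) (J : euclidean_jordan E).

Local Notation "x *o y" := (jmul J x y) (at level 40, left associativity).
Local Notation dot := (jdot J).
Local Notation jhorner := (jhorner J).

(** This is the Peirce equation: multiplication by [c] is a root of [2 X^3 - 3 X^2 + X], with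
    eigenvalues among 0, 1/2 and 1. It is [jmul_mulA] with all three factors equal to [c]. *)
Lemma idempotent_jmul3 c z : jidempotent J c ->
  c *o z = 3 *: (c *o (c *o z)) - 2 *: (c *o (c *o (c *o z))).
Proof.
move=> cc; rewrite -[in LHS]cc -[X in X *o c *o z]cc jmul_mulA cc.
by apply: (@jdot_inj _ _ J) => w; rewrite !(jdotDl, jdotNl, jdotZl); ring.
Qed.

(* [c] acts on its Peirce spaces as 1, 1/2 and 0; the first two components
   of [y] are [2 c(cy) - cy] and [4 (cy - c(cy))]. *)
Lemma idempotent_jdot_sqr c y : jidempotent J c ->
  dot c (y *o y) =
    dot (2 *: (c *o (c *o y)) - c *o y) (2 *: (c *o (c *o y)) - c *o y)
    + 8 * dot (c *o y - c *o (c *o y)) (c *o y - c *o (c *o y)).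
Proof.
move=> cc; rewrite -jdot_assoc.
have sa u v : dot (c *o u) v = dot u (c *o v).
  by rewrite (jmulC J c u) jdot_assoc.
have h1 := congr1 (dot y) (idempotent_jmul3 y cc).
have h2 := congr1 (dot y) (idempotent_jmul3 (c *o y) cc).
move: h1 h2; rewrite !(jdotDl, jdotDr, jdotNl, jdotNr) !jdotZl !jdotZr !sa; lra.
Qed.

Lemma idempotent_jdot_sqr_ge0 c y : jidempotent J c -> 0 <= dot c (y *o y).
Proof.
by move=> cc; rewrite idempotent_jdot_sqr // addr_ge0 ?mulr_ge0 ?jdot_ge0.
Qed.

Lemma idempotent_jdot_sqr_eq0 c y :
  jidempotent J c -> dot c (y *o y) = 0 -> c *o y = 0.
Proof.
move=> cc; rewrite idempotent_jdot_sqr //; set u := _ - _; set v := c *o y - _.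
have := jdot_ge0 J u; have := jdot_ge0 J v => *.
have u0 : u = 0 by apply: (@jdot_eq0 _ _ J); lra.
have v0 : v = 0 by apply: (@jdot_eq0 _ _ J); lra.
(* [u] is the Peirce component for 1, and [2 *: v] is half of the component for 1/2. *)
have -> : c *o y = u + 2 *: v.
  by apply: (@jdot_inj _ _ J) => w; rewrite !(jdotDl, jdotNl, jdotZl); ring.
by rewrite u0 v0 scaler0 addr0.
Qed.

Lemma idempotent_jdot_ge0 c d :
  jidempotent J c -> jidempotent J d -> 0 <= dot c d.
Proof. by move=> cc <-; exact: idempotent_jdot_sqr_ge0. Qed.

Lemma idempotent_orthogonal c d :
  jidempotent J c -> jidempotent J d -> dot c d = 0 -> c *o d = 0.
Proof. by move=> cc dd h; apply: idempotent_jdot_sqr_eq0; rewrite ?dd. Qed.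

(** Pair the hypothesis with [jhorner x k]. As multiplication by [x - a e] is self-adjoint, this
    gives a sum of two squared norms equal to zero. *)
Lemma jhorner_sum_squares x k a b :
  jhorner x ((('X - a%:P) ^+ 2 + (b ^+ 2)%:P) * k) = 0 ->
  jhorner x (('X - a%:P) * k) = 0 /\ b *: jhorner x k = 0.
Proof.
rewrite mulrDl expr2 -mulrA mul_polyC linearD linearZ /=.
rewrite (jhornerM J x ('X - _)).
set v := jhorner x (_ * k); set y := jhorner x k => h.
have := congr1 (dot^~ y) h; rewrite /= jdotDl jdotZl jdot0l.
rewrite (jmulC J _ v) jdot_assoc -jhornerM -/v => sum0.
have bE : dot (b *: y) (b *: y) = b ^+ 2 * dot y y.
  by rewrite jdotZl jdotZr mulrA -expr2.
have := jdot_ge0 J v; have := jdot_ge0 J (b *: y); move: sum0; rewrite -bE => *.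
by split; apply: (@jdot_eq0 _ _ J); lra.
Qed.

(** Stated for every divisor [q] of [p], so that real roots can be removed by induction on the
    size. *)
Lemma annihilator_splits x (p q : {poly R}) :
  size p = (jdegree J x).+1 -> jhorner x p = 0 -> q %| p ->
  exists2 s, uniq s & q %= \prod_(a <- s) ('X - a%:P).
Proof.
move=> size_p hp.
have p0 : p != 0 by rewrite -size_poly_gt0 size_p.
(* By [jhorner_sum_squares] the cofactor [k] annihilates [x] if [b] is nonzero, and
   [('X - a%:P) * k] does if [b = 0]; both have smaller degree than [p]. The case [b = 0] excludes
   double roots. *)
have no_square a b : ~ (('X - a%:P) ^+ 2 + (b ^+ 2)%:P %| p).
  set d := _ + _; case/dvdpP => k pE.
  have size_d : size d = 3%N.
    rewrite size_polyDl size_exp_XsubC //.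
    exact: leq_ltn_trans (size_polyC_leq1 _) _.
  have d0 : d != 0 by rewrite -size_poly_gt0 size_d.
  have k0 : k != 0 by apply: contra_neq p0; rewrite pE => ->; rewrite mul0r.
  have size_k : size p = (size k).+2 by rewrite pE size_mul // size_d addn3.
  move: hp; rewrite pE mulrC => /jhorner_sum_squares[h1 /eqP].
  rewrite scaler_eq0 => /orP[/eqP b0|/eqP h2]; last first.
    by have := jdegree_min k0 h2; rewrite ltnNge -ltnS -size_p size_k leqnSn.
  have := jdegree_min _ h1; rewrite mulf_eq0 polyXsubC_eq0 (negPf k0).
  move=> /(_ isT).
  by rewrite size_mul ?polyXsubC_eq0 // size_XsubC -ltnS -size_p size_k ltnn.
have [n] := ubnP (size q); elim: n q => // n IH q; rewrite ltnS => le_qn q_p.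
have q0 : q != 0 by apply: contraTneq q_p => ->; rewrite dvd0p.
have [le_q1|gt_q1] := leqP (size q) 1.
  exists [::] => //.
  by rewrite big_nil -size_poly_eq1 eqn_leq le_q1 size_poly_gt0.
have [a [b []]] := real_root_or_quadratic_factor gt_q1.
  by move/dvdp_trans/(_ q_p)/no_square.
rewrite root_factor_theorem => /dvdpP[k qE].
have k0 : k != 0 by apply: contra_neq q0; rewrite qE => ->; rewrite mul0r.
have k_p : k %| p by apply: dvdp_trans q_p; rewrite qE dvdp_mulr.
have [||s us ks] := IH k => //.
  rewrite (leq_trans _ le_qn) // qE mulrC size_mul ?polyXsubC_eq0 //.
  by rewrite size_XsubC.
exists (a :: s); last by rewrite big_cons qE mulrC eqp_mul2l // polyXsubC_eq0.
rewrite /= us andbT; apply/negP => a_s; apply: (no_square a 0).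
rewrite expr0n /= polyC0 addr0 expr2; apply: dvdp_trans q_p.
rewrite qE dvdp_mul2r ?polyXsubC_eq0 // -root_factor_theorem.
by rewrite (eqp_root ks) root_prod_XsubC.
Qed.
End Idempotents.

(** * Spectral decomposition and Jordan frames *)

Section IdempotentSystems.
Variables (R : realType) (E : vectType R) (J : euclidean_jordan E).

Local Notation "x *o y" := (jmul J x y) (at level 40, left associativity).
Local Notation dot := (jdot J).
Local Notation jhorner := (jhorner J).

(** A Jordan frame with primitivity weakened to being nonzero; the length [k] may be smaller than
    the rank. *)
Definition idempotent_system k (c : 'I_k -> E) : Prop :=
  [/\ forall i, jidempotent J (c i), forall i, c i != 0,
      forall i j, i != j -> c i *o c j = 0 & \sum_i c i = jone J].

Lemma spectral_decomposition d x : jdegree J x = d ->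
  exists (c : 'I_d -> E) (lam : 'I_d -> R),
    idempotent_system c /\ x = \sum_i lam i *: c i.
Proof.
move=> xd; have [p [size_p hp]] := jdegree_annihilator J x.
have [s us ps] := annihilator_splits size_p hp (dvdpp p).
have size_s : size s = d.
  by apply: succn_inj; rewrite -(size_prod_XsubC s id) -(eqp_size ps) size_p xd.
pose a (i : 'I_d) := s`_i.
have a_inj i j : (a i == a j) = (i == j).
  by rewrite /a nth_uniq ?size_s.
(* Evaluation at [x] only depends on the values at the roots [a i], so each identity between the
   idempotents below is checked on these values. *)
have eval0 q : (forall i, q.[a i] = 0) -> jhorner x q = 0.
  move=> qa; have : p %| q.
    rewrite (eqp_dvdl _ ps); apply: uniq_roots_dvdp; last by rewrite uniq_rootsE.
    apply/(all_nthP 0) => i; rewrite size_s => lt_id.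
    by apply/rootP; exact: (qa (Ordinal lt_id)).
  by case/dvdpP => k ->; rewrite jhornerM hp jmul0r.
pose k i := \prod_(j | j != i) ('X - (a j)%:P).
have prodE i : \prod_(b <- s) ('X - b%:P) = ('X - (a i)%:P) * k i.
  by rewrite (big_nth 0) big_mkord size_s (bigD1 i).
have k0 i : k i != 0 by apply: monic_neq0; apply: monic_prod_XsubC.
have size_k i : size (k i) = d.
  apply: succn_inj; rewrite -size_s -(size_prod_XsubC s id) (prodE i).
  by rewrite size_mul ?polyXsubC_eq0 // size_XsubC.
have kE i j : ((k i).[a j] == 0) = (j != i).
  rewrite horner_prod; apply/prodf_eq0/idP => [[l l_i]|ji].
    by rewrite !hornerE subr_eq0 a_inj => /eqP ->.
  by exists j; rewrite // !hornerE subrr.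
(* Lagrange basis polynomials of the roots; their values at [x] are the idempotents. *)
pose l i := (k i).[a i]^-1 *: k i.
have lE i j : (l i).[a j] = (i == j)%:R.
  rewrite hornerZ; have [<-|neq_ij] := eqVneq i j.
    by rewrite mulVf // kE eqxx.
  by apply/eqP; rewrite mulf_eq0 kE (eq_sym j) neq_ij orbT.
have sum_delta (f : 'I_d -> R) j : \sum_i f i * (i == j)%:R = f j.
  rewrite (bigD1 j) //= eqxx mulr1 big1 ?addr0 // => i /negPf ->.
  by rewrite mulr0.
exists (fun i => jhorner x (l i)), a; split; first split.
- move=> i; rewrite /jidempotent -jhornerM; apply/eqP.
  rewrite -subr_eq0 -linearB; apply/eqP/eval0 => j.
  by rewrite hornerD hornerN hornerM lE; case: eqP; rewrite ?mulr1 ?mulr0 subrr.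
(* [k i] has size [d], hence degree [d - 1], too small to annihilate [x]. *)
- move=> i; rewrite linearZ scaler_eq0 invr_eq0 kE eqxx /=; apply/eqP => hk.
  by have := jdegree_min (k0 i) hk; rewrite size_k xd ltnn.
- move=> i j neq_ij; rewrite -jhornerM; apply: eval0 => t.
  rewrite hornerM !lE; case: (eqVneq i t) neq_ij => [->|_].
    by rewrite eq_sym => /negPf ->; rewrite mulr0.
  by rewrite mul0r.
- rewrite -(jhorner1 J x) -linear_sum; apply/eqP; rewrite -subr_eq0 -linearB.
  apply/eqP/eval0 => j; rewrite hornerD hornerN hornerC horner_sum.
  by under eq_bigr do rewrite lE -[_%:R]mul1r; rewrite sum_delta subrr.
- rewrite -[LHS](jhornerX J); apply/eqP; rewrite -subr_eq0.
  under eq_bigr do rewrite -linearZ.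
  rewrite -linear_sum -linearB; apply/eqP/eval0 => j.
  rewrite hornerD hornerN hornerX horner_sum.
  by under eq_bigr do rewrite hornerZ lE; rewrite sum_delta subrr.
Qed.

Lemma idempotent_system_mul k (c : 'I_k -> E) (lam mu : 'I_k -> R) :
  idempotent_system c ->
  (\sum_i lam i *: c i) *o (\sum_i mu i *: c i) = \sum_i (lam i * mu i) *: c i.
Proof.
move=> [cc _ co _]; rewrite jmul_suml; apply: eq_bigr => i _.
rewrite jmul_sumr (bigD1 i) //= big1 => [|j neq_ji].
  by rewrite addr0 jmulZl jmulZr cc scalerA.
by rewrite jmulZl jmulZr co 1?eq_sym // !scaler0.
Qed.

Lemma idempotent_system_jhorner k (c : 'I_k -> E) (lam : 'I_k -> R) q :
  idempotent_system c ->
  jhorner (\sum_i lam i *: c i) q = \sum_i q.[lam i] *: c i.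
Proof.
move=> cs; have powE n :
    jpow J (\sum_i lam i *: c i) n = \sum_i lam i ^+ n *: c i.
  elim: n => [|n IH] /=; last first.
    rewrite -/(jpow J _ n) IH idempotent_system_mul //.
    by apply: eq_bigr => i _; rewrite exprS.
  by case: cs => _ _ _ <-; apply: eq_bigr => i _; rewrite expr0 scale1r.
rewrite /jhorner; under eq_bigr do rewrite powE scaler_sumr.
rewrite exchange_big; apply: eq_bigr => i _ /=.
by rewrite horner_coef scaler_suml; apply: eq_bigr => n _; rewrite scalerA.
Qed.

Lemma idempotent_system_le_jrank k (c : 'I_k -> E) :
  idempotent_system c -> (k <= jrank J)%N.
Proof.
(* The coefficients are pairwise distinct, and each is a root of any annihilator of [x], so [x] has
   degree at least [k]. *)
move=> cs; pose x := \sum_(i < k) (i%:R : R) *: c i.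
apply: leq_trans (jrank_ge J x); rewrite -ltnS.
have [p [size_p hp]] := jdegree_annihilator J x; rewrite -size_p.
have p_root (j : 'I_k) : root p j%:R.
  have : (\sum_(i < k) p.[i%:R] *: c i) *o c j = 0.
    by rewrite -(idempotent_system_jhorner (fun i => i%:R)) // hp jmul0l.
  case: cs => cc c0 co _; rewrite jmul_suml (bigD1 j) //= big1 => [|i neq_ij].
    rewrite addr0 jmulZl cc => /eqP; rewrite scaler_eq0 (negPf (c0 j)) orbF.
    by move/eqP/rootP.
  by rewrite jmulZl co // scaler0.
have p0 : p != 0 by rewrite -size_poly_gt0 size_p.
rewrite -[k](size_iota 0) -(size_map (fun i => i%:R : R)).
apply: max_poly_roots p0 _ _.
  apply/allP => _ /mapP[i i_k ->]; rewrite mem_iota in i_k.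
  exact: (p_root (Ordinal i_k)).
by rewrite map_inj_uniq ?iota_uniq // => i j /eqP; rewrite eqr_nat => /eqP.
Qed.

(** The summand [b] takes the new index 0, and [a] replaces [c i] among the shifted old indices. *)
Lemma idempotent_system_split k (c : 'I_k -> E) i a b :
  idempotent_system c -> jidempotent J a -> jidempotent J b ->
  a != 0 -> b != 0 -> c i = a + b ->
  idempotent_system (fun j : 'I_k.+1 =>
    if unlift ord0 j is Some l then if l == i then a else c l else b).
Proof.
move=> [cc c0 co c1] aa bb a0 b0 ciE.
(* Expanding the square of [c i] gives [a + b + 2 (a *o b) = a + b]. *)
have ab : a *o b = 0.
  have := cc i; rewrite ciE /jidempotent jmulDl !jmulDr aa bb (jmulC J b a).
  move=> h.
  apply: (@jdot_inj _ _ J) => w; move: (congr1 (dot^~ w) h).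
  by rewrite /= !jdotDl jdot0l; lra.
(* The inner products of [a] and [b] with [c l] are nonnegative and add up to that of [c i] with
   [c l], which is 0. *)
have orth l : l != i -> a *o c l = 0 /\ b *o c l = 0.
  move=> neq_li; have : dot (c i) (c l) = 0.
    by rewrite -(cc l) -jdot_assoc co ?jdot0l // eq_sym.
  have := idempotent_jdot_ge0 aa (cc l); have := idempotent_jdot_ge0 bb (cc l).
  rewrite ciE jdotDl => *; split; apply: idempotent_orthogonal => //; lra.
split.
- by move=> j; case: unliftP => [l _|_] //; case: ifP => _ //; apply: cc.
- by move=> j; case: unliftP => [l _|_] //; case: ifP => _ //; apply: c0.
- move=> j j'; case: unliftP => [l ->|->]; case: unliftP => [l' ->|->].
  + rewrite (inj_eq lift_inj) => neq_ll'.
    case: (eqVneq l i) neq_ll' => [->|li] neq;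
      case: (eqVneq l' i) neq => [e|l'i] neq.
    * by move: neq; rewrite ?e ?eqxx.
    * by case: (orth l' l'i).
    * by rewrite jmulC; case: (orth l li).
    * exact: co.
  + by move=> _; case: eqVneq => [_|/orth[_]]; rewrite ?ab // jmulC.
  + by move=> _; case: eqVneq => [_|/orth[_]]; rewrite // jmulC.
  + by rewrite eqxx.
- rewrite big_ord_recl unlift_none -c1 [in RHS](bigD1 i) //= ciE.
  rewrite (addrC a b) -addrA.
  congr (_ + _); under eq_bigr do rewrite liftK.
  rewrite (bigD1 i) //= eqxx; congr (_ + _).
  by apply: eq_bigr => l /negPf ->.
Qed.

Lemma spectral_frame x : jdegree J x = jrank J ->
  exists (c : {ffun 'I_(jrank J) -> E}) (lam : 'I_(jrank J) -> R),
    jordan_frame J c /\ x = \sum_i lam i *: c i.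
Proof.
move=> /spectral_decomposition[c [lam [cs xE]]].
exists [ffun i => c i], lam; split; last first.
  by rewrite xE; apply: eq_bigr => i _; rewrite ffunE.
case: (cs) => cc c0 co c1; split; first last.
- by rewrite -c1; apply: eq_bigr => i _; rewrite ffunE.
- by move=> i j; rewrite !ffunE; exact: co.
move=> i; rewrite ffunE; split=> // -[a [b [aa bb a0 b0 cE]]].
have := idempotent_system_le_jrank (idempotent_system_split cs aa bb a0 b0 cE).
by rewrite ltnn.
Qed.

Lemma jordan_frame_system k (c : {ffun 'I_k -> E}) :
  jordan_frame J c -> idempotent_system c.
Proof. by case=> cp co c1; split=> // i; case: (cp i). Qed.
End IdempotentSystems.

(** * Polynomial functions of one real variable *)

Section PolynomialFunctions.
Variable R : realType.

Definition polyfun (f : R -> R) : Prop :=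
  exists p : {poly R}, forall t, f t = p.[t].

Lemma polyfun_cst a : polyfun (fun=> a).
Proof. by exists a%:P => t; rewrite hornerC. Qed.

Lemma polyfun_id : polyfun id.
Proof. by exists 'X => t; rewrite hornerX. Qed.

Lemma polyfunD f g : polyfun f -> polyfun g -> polyfun (fun t => f t + g t).
Proof. by move=> [p fE] [q gE]; exists (p + q) => t; rewrite hornerD fE gE. Qed.

Lemma polyfunM f g : polyfun f -> polyfun g -> polyfun (fun t => f t * g t).
Proof. by move=> [p fE] [q gE]; exists (p * q) => t; rewrite hornerM fE gE. Qed.

Lemma polyfun_sum (I : Type) (r : seq I) (P : pred I) (F : I -> R -> R) :
  (forall i, polyfun (F i)) -> polyfun (fun t => \sum_(i <- r | P i) F i t).
Proof.
move=> /choice[p pE]; exists (\sum_(i <- r | P i) p i) => t.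
by rewrite horner_sum; apply: eq_bigr.
Qed.

Lemma polyfun_prod (I : Type) (r : seq I) (P : pred I) (F : I -> R -> R) :
  (forall i, polyfun (F i)) -> polyfun (fun t => \prod_(i <- r | P i) F i t).
Proof.
move=> /choice[p pE]; exists (\prod_(i <- r | P i) p i) => t.
by rewrite horner_prod; apply: eq_bigr.
Qed.

Lemma polyfun_det n (M : R -> 'M[R]_n) :
  (forall i j, polyfun (fun t => M t i j)) -> polyfun (fun t => \det (M t)).
Proof.
move=> Mpoly; apply: polyfun_sum => s.
apply: polyfunM; first exact: polyfun_cst.
by apply: polyfun_prod => i; apply: Mpoly.
Qed.

(** A negative value of [f] would persist near [t] by continuity; [g] would vanish there, hence have
    more roots than its degree allows. *)
Lemma polyfun_ge0 f g : polyfun f -> polyfun g -> (exists t, g t != 0) ->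
  (forall t, g t != 0 -> 0 <= f t) -> forall t, 0 <= f t.
Proof.
move=> [p fE] [q gE] [t1 g1] f_ge0 t; rewrite fE leNgt; apply/negP => pt_lt0.
have q0 : q != 0 by apply: contra_neq g1; rewrite gE => ->; rewrite horner0.
have e_gt0 : 0 < - p.[t] by rewrite oppr_gt0.
have [d d_gt0 pd] := @poly_cont R t p _ e_gt0.
(* Distinct points near [t]; the denominator starts at 2 to keep the distance strictly below [d]. *)
pose u (i : nat) : R := t + d / i.+2%:R.
have u_root i : root q (u i).
  apply/rootP/eqP; rewrite -gE; apply/negPn/negP => /f_ge0; rewrite fE leNgt.
  case/negP; have : `|u i - t| < d.
    rewrite addrAC subrr add0r ger0_norm ?divr_ge0 ?ltW //.
    by rewrite ltr_pdivrMr // ltr_pMr // ltr1n.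
  by move/pd; rewrite ltr_norml => /andP[_]; lra.
have : (size [seq u i | i <- iota 0 (size q)] < size q)%N.
  apply: max_poly_roots q0 _ _; first by apply/allP => _ /mapP[i _ ->].
  rewrite map_inj_uniq ?iota_uniq // => i j /addrI.
  by move/(mulfI (lt0r_neq0 d_gt0))/invr_inj/eqP; rewrite eqr_nat => /eqP[].
by rewrite size_map size_iota ltnn.
Qed.
End PolynomialFunctions.

(** * Genericity of the maximal degree along polynomial curves *)

Section Perturbation.
Variables (R : realType) (E : vectType R) (J : euclidean_jordan E).

Local Notation "x *o y" := (jmul J x y) (at level 40, left associativity).
Local Notation b := (vbasis {:E}).

Definition polycurve (f : R -> E) : Prop :=
  forall i, polyfun (fun t => coord b i (f t)).

Lemma polycurve_cst x : polycurve (fun=> x).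
Proof. by move=> i; apply: polyfun_cst. Qed.

Lemma polycurveD f g :
  polycurve f -> polycurve g -> polycurve (fun t => f t + g t).
Proof.
move=> fp gp i; have [p pE] := polyfunD (fp i) (gp i).
by exists p => t; rewrite linearD -pE.
Qed.

Lemma polycurveZ a f :
  polyfun a -> polycurve f -> polycurve (fun t => a t *: f t).
Proof.
move=> ap fp i; have [p pE] := polyfunM ap (fp i).
by exists p => t; rewrite linearZ -pE.
Qed.

(** The coordinates of a product are bilinear in those of the factors, with the structure constants
    of the basis as coefficients. *)
Lemma polycurve_jmul f g :
  polycurve f -> polycurve g -> polycurve (fun t => f t *o g t).
Proof.
move=> fp gp i.
have [|p pE] := @polyfun_sum _ _ (index_enum 'I_(\dim {:E})) predT
    (fun j t => \sum_k
       coord b j (f t) * (coord b k (g t) * coord b i (b`_j *o b`_k))).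
  move=> j; apply: polyfun_sum => k.
  apply: polyfunM => //; apply: polyfunM => //.
  exact: polyfun_cst.
exists p => t; rewrite -pE.
rewrite {1}(coord_vbasis (memvf (f t))) {1}(coord_vbasis (memvf (g t))).
rewrite jmul_suml linear_sum; apply: eq_bigr => j _.
rewrite jmul_sumr linear_sum; apply: eq_bigr => k _.
by rewrite jmulZl jmulZr !linearZ.
Qed.

Lemma polycurve_jpow f n : polycurve f -> polycurve (fun t => jpow J (f t) n).
Proof.
move=> fp; elim: n => [|n IH]; first exact: polycurve_cst.
exact: polycurve_jmul.
Qed.

Definition powmx r (x : E) : 'M[R]_(r, \dim {:E}) :=
  \matrix_(i, j) coord b j (jpow J x i).

Lemma powmx_mul r x (u : 'rV[R]_r) :
  u *m powmx r x = 0 <-> jhorner J x (rVpoly u) = 0.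
Proof.
have uE : jhorner J x (rVpoly u) = \sum_i u 0 i *: jpow J x i.
  rewrite (@jhorner_widen _ _ _ _ _ r) ?size_poly //.
  by apply: eq_bigr => i _; rewrite coef_rVpoly_ord.
split=> [/rowP h|h].
  rewrite uE (coord_vbasis (memvf (\sum_i _))) big1 // => j _.
  have := h j; rewrite !mxE linear_sum => h'.
  rewrite [X in X *: _](_ : _ = 0) ?scale0r //.
  by rewrite -[RHS]h'; apply: eq_bigr => i _; rewrite linearZ mxE.
apply/rowP => j; rewrite !mxE -[RHS](linear0 (coord b j)) -h uE linear_sum.
by apply: eq_bigr => i _; rewrite linearZ mxE.
Qed.

(** By [powmx_mul], a relation between the rows is an annihilating polynomial of size at most
    [r]. *)
Lemma powmx_row_free r x : row_free (powmx r x) = (r <= jdegree J x)%N.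
Proof.
apply/idP/idP => [free_r|le_rd].
  rewrite leqNgt; apply/negP => lt_dr.
  have [p [size_p hp]] := jdegree_annihilator J x.
  have pE : rVpoly (poly_rV p : 'rV_r) = p by rewrite poly_rV_K // size_p.
  have /powmx_mul : jhorner J x (rVpoly (poly_rV p : 'rV_r)) = 0 by rewrite pE.
  move=> h; have : poly_rV p = 0 :> 'rV_r.
    by apply: (row_free_inj free_r); rewrite h mul0mx.
  move=> h0; move: size_p; rewrite -pE h0 linear0 size_poly0 //.
rewrite -kermx_eq0; apply/rowV0P => u /sub_kermxP/powmx_mul hu.
rewrite -[u]rVpolyK; suff -> : rVpoly u = 0 by rewrite linear0.
apply/eqP; apply: contraT => /jdegree_min/(_ hu); rewrite ltnNge.
by rewrite (leq_trans (size_poly _ _)).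
Qed.

Lemma generic_jdegree f t0 : polycurve f -> jdegree J (f t0) = jrank J ->
  exists g, [/\ polyfun g, g t0 != 0 &
    forall t, g t != 0 -> jdegree J (f t) = jrank J].
Proof.
move=> fp ft0; pose r := jrank J.
have /row_freeP[B hB] : row_free (powmx r (f t0)) by rewrite powmx_row_free ft0.
(* [B] is a right inverse at [t0], so the determinant is 1 there. Wherever it is nonzero, the power
   matrix stays row free and the degree reaches the rank. *)
exists (fun t => \det (powmx r (f t) *m B)); split.
- apply: polyfun_det => i j.
  have [|p pE] := @polyfun_sum _ _ (index_enum 'I_(\dim {:E})) predT
    (fun k t => coord b k (jpow J (f t) i) * B k j).
    move=> k; apply: polyfunM; last exact: polyfun_cst.
    exact: (polycurve_jpow i fp k).
  by exists p => t; rewrite -pE mxE; apply: eq_bigr => k _; rewrite mxE.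
- by rewrite hB det1 oner_neq0.
- move=> t; rewrite -unitfE -unitmxE => u.
  apply/eqP; rewrite eqn_leq jrank_ge -powmx_row_free; apply/row_freeP.
  by exists (B *m invmx (powmx r (f t) *m B)); rewrite mulmxA mulmxV.
Qed.
End Perturbation.

Local Open Scope classical_set_scope.

(** * Permutations acting on tensors *)

Section Tensors.
Variables (R : realType) (m : nat).

Lemma prod_perm (s : 'S_m) (F : 'I_m -> R) : \prod_j F (s j) = \prod_j F j.
Proof. by rewrite [RHS](reindex_inj (@perm_inj _ s)). Qed.

Lemma sum_index_perm k (s : 'S_m) (F : {ffun 'I_m -> 'I_k} -> R) :
  \sum_(I : {ffun 'I_m -> 'I_k}) F [ffun j => I (s j)] = \sum_I F I.
Proof.
pose h (I : {ffun 'I_m -> 'I_k}) := [ffun j => I (s j)].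
rewrite [RHS](reindex_inj (h := h)) //.
move=> I I' /ffunP eqII'; apply/ffunP => j.
by have := eqII' (s^-1%g j); rewrite !ffunE permKV.
Qed.

Lemma symmetric_tensor_perm k (s : 'S_k) (B : tensor R k m) :
  symmetric_tensor B -> symmetric_tensor (tensor_perm s B).
Proof.
move=> symB r I; rewrite !ffunE -[RHS](symB r).
by congr (B _); apply/ffunP => j; rewrite !ffunE.
Qed.

Lemma tensor_permK k (s : 'S_k) :
  cancel (@tensor_perm R k m s) (tensor_perm s^-1).
Proof.
move=> B; apply/ffunP => I; rewrite !ffunE; congr (B _).
by apply/ffunP => j; rewrite !ffunE permKV.
Qed.

(** Stability under all permutations suffices: the inverse permutation supplies preimages. *)
Lemma permutation_invariantP k (K : set (tensor R k m)) :
  (forall s B, K B -> K (tensor_perm s B)) -> permutation_invariant K.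
Proof.
move=> KP s; apply/seteqP; split=> [_ [B KB <-]|B KB]; first exact: KP.
exists (tensor_perm s^-1 B); first exact: KP.
by rewrite -{1}(invgK s) tensor_permK.
Qed.

Lemma tensor_dot_perm k (s : 'S_k) (B : tensor R k m) (x : 'rV[R]_k) :
  tensor_dot (tensor_perm s B) (tensor_power m x) =
  tensor_dot B (tensor_power m (\row_i x 0 (s^-1%g i))).
Proof.
pose h (I : {ffun 'I_m -> 'I_k}) := [ffun j => s (I j)].
rewrite /tensor_dot [RHS](reindex_inj (h := h)).
  apply: eq_bigr => I _; rewrite !ffunE; congr (_ * _).
  by apply: eq_bigr => j _; rewrite !mxE ffunE permK.
move=> I I' /ffunP eqII'; apply/ffunP => j.
by have := eqII' j; rewrite !ffunE => /perm_inj.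
Qed.

Lemma copositive_permutation_invariant k :
  permutation_invariant (@copositive R k m).
Proof.
apply: permutation_invariantP => s B [symB posB]; split.
  exact: symmetric_tensor_perm.
by move=> x x_ge0; rewrite tensor_dot_perm; apply: posB => i; rewrite mxE.
Qed.
End Tensors.

(** * Tensors evaluated at frames, and copositivity *)

Section JordanTensors.
Variables (R : realType) (E : vectType R) (J : euclidean_jordan E) (m : nat).

Local Notation b := (vbasis {:E}).

Lemma symmetric_tensor_at k (A : jtensor E m) (c : {ffun 'I_k -> E}) :
  symmetric_tensor A -> symmetric_tensor (tensor_at J A c).
Proof.
move=> symA s I; rewrite !ffunE /jtensor_dot -[LHS](sum_index_perm s).
apply: eq_bigr => L _; rewrite -[LHS](sum_index_perm s); apply: eq_bigr => L' _.
rewrite symA !ffunE; congr (_ * _ * _).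
  by rewrite -[RHS](prod_perm s); apply: eq_bigr => j _; rewrite !ffunE.
by rewrite -[RHS](prod_perm s); apply: eq_bigr => j _; rewrite !ffunE.
Qed.

Lemma tensor_at_frame_act (A : jtensor E m) (s : 'S_(jrank J)) c :
  tensor_at J A (frame_act s c) = tensor_perm s (tensor_at J A c).
Proof.
apply/ffunP => I; rewrite !ffunE; congr jtensor_dot.
apply/ffunP => L; rewrite !ffunE; apply: eq_bigr => j _.
by rewrite !ffunE.
Qed.

(** Comparing [F] with all frames makes any two choices of [F] agree. The representative [d] of [c]
    lies in [F], and undoing its permutation transports membership in [K] from [d] to [c]. *)
Lemma frame_inter_frames (K : set (tensor R (jrank J) m)) Fc F :
  permutation_invariant K -> complete_representatives J Fc ->
  Fc `<=` F -> F `<=` jframes J ->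
  @frame_inter R E J m K F = frame_inter K (jframes J).
Proof.
move=> invK [_ rep] FcF FJ; apply/seteqP; split=> A inA c Fc_c; last first.
  exact: inA (FJ _ Fc_c).
have [d [[Fc_d [s dE]] _]] := rep c Fc_c.
have [symA KA] := inA d (FcF _ Fc_d); split=> //.
move: KA; rewrite dE tensor_at_frame_act => KA.
rewrite -(invK s^-1%g); exists (tensor_perm s (tensor_at J A c)) => //.
exact: tensor_permK.
Qed.

(** Multilinear expansion of the power of a combination of the [c i]; it turns copositivity of
    [tensor_at J A c] into a condition on [A] over the cone spanned by the [c i]. *)
Lemma tensor_at_power k (A : jtensor E m) (c : {ffun 'I_k -> E})
    (x : 'rV[R]_k) :
  tensor_dot (tensor_at J A c) (tensor_power m x) =
  jtensor_dot J A (pure_tensor (fun=> \sum_i x 0 i *: c i)).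
Proof.
have pureE L' : pure_tensor (m := m) (fun=> \sum_i x 0 i *: c i) L' =
    \sum_(I : {ffun 'I_m -> 'I_k})
      (\prod_j x 0 (I j)) * pure_tensor (fun j => c (I j)) L'.
  rewrite ffunE; under eq_bigr do rewrite linear_sum.
  rewrite bigA_distr_bigA; apply: eq_bigr => I _ /=.
  by rewrite ffunE -big_split; apply: eq_bigr => j _; rewrite linearZ.
rewrite /tensor_dot /jtensor_dot; under eq_bigr do rewrite !ffunE mulr_suml.
rewrite exchange_big; apply: eq_bigr => L _ /=.
under eq_bigr do rewrite mulr_suml.
rewrite exchange_big; apply: eq_bigr => L' _ /=.
rewrite pureE mulr_sumr mulr_suml; apply: eq_bigr => I _; ring.
Qed.

Lemma polyfun_jtensor_dot (A : jtensor E m) (f : R -> E) : polycurve f ->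
  polyfun (fun t => jtensor_dot J A (pure_tensor (fun=> f t))).
Proof.
move=> fp; apply: polyfun_sum => L; apply: polyfun_sum => L'.
apply: polyfunM; last exact: polyfun_cst.
apply: polyfunM; first exact: polyfun_cst.
have [|p pE] := @polyfun_prod _ _ (index_enum 'I_m) predT
    (fun j t => coord b (L' j) (f t)).
  by move=> j; apply: fp.
by exists p => t; rewrite ffunE -pE.
Qed.

Lemma jcopositive_frames :
  jcopositive J = frame_inter (@copositive R (jrank J) m) (jframes J).
Proof.
apply/seteqP; split=> [A [symA posA] c frame_c | A inA].
  split=> //; split; first exact: symmetric_tensor_at.
  move=> x x_ge0; rewrite tensor_at_power; apply: posA.
  (* Nonnegative combinations of a frame are squares, by square roots of the coefficients. *)
  exists (\sum_i Num.sqrt (x 0 i) *: c i).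
  rewrite (idempotent_system_mul _ _ (jordan_frame_system frame_c)).
  by apply: eq_bigr => i _; rewrite -expr2 sqr_sqrtr.
have [x0 x0r] := jrank_attained J.
(* A frame must exist for the intersection to impose symmetry on [A]. *)
have [c0 [_ [frame_c0 _]]] := spectral_frame x0r.
split=> [|_ [x ->]]; first by case: (inA c0 frame_c0).
(* The line through [x0] at [t = 0], where the degree is maximal, and [x] at [t = 1]. *)
pose f t := x0 + t *: (x - x0).
have fp : polycurve f.
  apply: polycurveD; first exact: polycurve_cst.
  by apply: polycurveZ; [exact: polyfun_id | exact: polycurve_cst].
have [g [gp g0 gr]] : exists g, [/\ polyfun g, g 0 != 0 &
    forall t, g t != 0 -> jdegree J (f t) = jrank J].
  by apply: generic_jdegree; rewrite // /f scale0r addr0.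
have f1 : f 1 = x by rewrite /f scale1r addrC subrK.
(* Generalizing 1 asks for nonnegativity on the whole line, which [polyfun_ge0] reduces to the
   parameters of maximal degree. *)
rewrite -f1; move: (1 : R).
apply: (polyfun_ge0 _ gp).
- exact/polyfun_jtensor_dot/polycurve_jmul.
- by exists 0.
move=> t /gr/spectral_frame[c [lam [frame_c ftE]]].
have [_ [_ posc]] := inA c frame_c.
rewrite ftE (idempotent_system_mul _ _ (jordan_frame_system frame_c)).
have := posc (\row_i (lam i * lam i)); rewrite tensor_at_power.
under eq_bigr do rewrite mxE; apply=> i.
by rewrite mxE -expr2 sqr_ge0.
Qed.
End JordanTensors.

Theorem theorem4p5 (R : realType) (E : vectType R) (J : euclidean_jordan E)
    (m : nat) (hm : (0 < m)%N)
    (Fc : set {ffun 'I_(jrank J) -> E}) (hFc : complete_representatives J Fc) :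
  [/\ forall K : set (tensor R (jrank J) m),
        K `<=` symmetric_tensor -> permutation_invariant K ->
        forall F1 F2 : set {ffun 'I_(jrank J) -> E},
          Fc `<=` F1 -> F1 `<=` jframes J ->
          Fc `<=` F2 -> F2 `<=` jframes J ->
          frame_inter K F1 = frame_inter K F2,
      permutation_invariant (@copositive R (jrank J) m),
      forall F1 F2 : set {ffun 'I_(jrank J) -> E},
        Fc `<=` F1 -> F1 `<=` jframes J ->
        Fc `<=` F2 -> F2 `<=` jframes J ->
        frame_inter (@copositive R (jrank J) m) F1 =
        frame_inter (@copositive R (jrank J) m) F2 &
      forall F : set {ffun 'I_(jrank J) -> E},
        Fc `<=` F -> F `<=` jframes J ->
        jcopositive J = frame_inter (@copositive R (jrank J) m) F].
Proof.
have eq_inter K : permutation_invariant K ->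
    forall F1 F2 : set {ffun 'I_(jrank J) -> E},
    Fc `<=` F1 -> F1 `<=` jframes J -> Fc `<=` F2 -> F2 `<=` jframes J ->
    @frame_inter R E J m K F1 = frame_inter K F2.
  move=> invK F1 F2 c1 j1 c2 j2.
  by rewrite !(frame_inter_frames invK hFc).
have invC := @copositive_permutation_invariant R m (jrank J).
split=> // [K _ invK||F FcF FJ]; [exact: eq_inter | exact: eq_inter |].
by rewrite (frame_inter_frames invC hFc) // -jcopositive_frames.
Qed.
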